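(* For each integer $m\ge 1$ there is an integer $n_0(m)$ such that every (abstract) rotation system of size at least $n_0(m)$ has a rotation subsystem equivalent to one of $\mathbf{C}_m$, $\mathbf{T}_m$, $(\mathbf{C}_m)^{-1}$, or $(\mathbf{T}_m)^{-1}$.
   Context: An (abstract) rotation system $\Pi$ on a finite set of integers $\{i_1,\ldots,i_n\}$ with $i_1<\cdots<i_n$ (its ground set; $n$ is its size) is an $n$-tuple $(\Pi(i_1),\ldots,\Pi(i_n))$, where each $\Pi(i_j)$ is a cyclic permutation (cyclic ordering) of $\{i_1,\ldots,i_n\}\setminus\{i_j\}$. Two rotation systems $\Pi,\Pi'$ are equivalent if there is a relabelling (bijection) of the ground elements of $\Pi'$ that turns $\Pi'$ into $\Pi$. The inverse $\Pi^{-1}$ is $((\Pi(i_1))^{-1},\ldots,(\Pi(i_n))^{-1})$, where $(\Pi(i_j))^{-1}$ is the inverse (reversed) cyclic permutation. For a subset $S$ of the ground set, the rotation subsystem induced by $S$ assigns to each $x\in S$ the cyclic order on $S\setminus\{x\}$ obtained from $\Pi(x)$ by deleting the elements not in $S$. For $m\ge 1$, $\mathbf{C}_m$ is the rotation system on $\{1,\ldots,m\}$ with $\mathbf{C}_m(i)=1\,2\cdots(i-1)\,(i+1)\cdots m$ (as a cyclic order) for each $i$, and $\mathbf{T}_m$ is the rotation system on $\{1,\ldots,m\}$ with $\mathbf{T}_m(i)=m\,(m-1)\cdots(i+1)\,1\,2\cdots(i-1)$ (as a cyclic order) for each $i$. *)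

(* Defs.v *)
From mathcomp Require Import all_boot all_order all_algebra finmap.
Set Implicit Arguments.
Unset Strict Implicit.
Unset Printing Implicit Defensive.

Local Open Scope fset_scope.

(* A cyclic permutation (a_1 a_2 ... a_k) is written as the duplicate-free
   sequence [:: a_1; ...; a_k]; two sequences denote the same cyclic permutation
   iff one is a rotation of the other. *)
Definition same_cyclic (T : Type) (s t : seq T) : Prop := exists k, s = rot k t.

(* The values of [rotation] outside the ground set are irrelevant. *)
Record rotation_system := RotationSystem {
  ground : {fset int};
  rotation : int -> seq int;
  rotationP : forall x, x \in ground -> perm_eq (rotation x) (ground `\ x)
}.

Definition equivalent (P P' : rotation_system) : Prop :=
  exists f : int -> int,
    [/\ {in ground P' &, injective f},
        f @` ground P' = ground P
      & forall x, x \in ground P' ->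
          same_cyclic (map f (rotation P' x)) (rotation P (f x))].

Fact inverse_subproof (P : rotation_system) (x : int) :
  x \in ground P -> perm_eq (rev (rotation P x)) (ground P `\ x).
Proof. by move=> xP; rewrite perm_rev rotationP. Qed.

Definition inverse (P : rotation_system) : rotation_system :=
  RotationSystem (@inverse_subproof P).

Fact induced_subproof (P : rotation_system) (S : {fset int})
    (sSP : S `<=` ground P) (x : int) :
  x \in S -> perm_eq [seq y <- rotation P x | y \in S] (S `\ x).
Proof.
move=> xS; have pP := rotationP (fsubsetP sSP x xS).
apply: uniq_perm; rewrite ?fset_uniq //.
  by rewrite filter_uniq // (perm_uniq pP) fset_uniq.
move=> y; rewrite mem_filter (perm_mem pP) !in_fsetD1.
by case yS: (y \in S); rewrite ?andbF //= (fsubsetP sSP y yS).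
Qed.

Definition induced (P : rotation_system) (S : {fset int})
    (sSP : S `<=` ground P) : rotation_system :=
  RotationSystem (induced_subproof sSP).

Definition first_integers (m : nat) : {fset int} :=
  [fset x in [seq Posz k | k <- iota 1 m]].

Lemma first_integersP (m : nat) (x : int) :
  reflect (exists2 i : nat, 1 <= i <= m & x = Posz i) (x \in first_integers m).
Proof.
rewrite !inE; apply: (iffP mapP) => -[i im ->]; exists i => //;
  by move: im; rewrite mem_iota add1n ltnS.
Qed.

(* For x = i in {1, ..., m}: 1 2 ... (i-1) (i+1) ... m. *)
Definition C_rotation (m : nat) (x : int) : seq int :=
  let i := absz x in
  [seq Posz k | k <- iota 1 i.-1 ++ iota i.+1 (m - i)].

(* For x = i in {1, ..., m}: m (m-1) ... (i+1) 1 2 ... (i-1). *)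
Definition T_rotation (m : nat) (x : int) : seq int :=
  let i := absz x in
  [seq Posz k | k <- rev (iota i.+1 (m - i)) ++ iota 1 i.-1].

Fact C_subproof (m : nat) (x : int) :
  x \in first_integers m ->
  perm_eq (C_rotation m x) (first_integers m `\ x).
Proof.
move=> /first_integersP[i /andP[i_gt0 le_im] ->]; rewrite /C_rotation /=.
have Em : iota 1 m = iota 1 i.-1 ++ i :: iota i.+1 (m - i).
  rewrite -{1}(subnKC le_im) -{1}(prednK i_gt0) addSnnS iotaD /=.
  by rewrite add1n prednK.
have um := iota_uniq 1 m; rewrite Em cat_uniq /= negb_or in um.
case/and3P: um => u1 /andP[i1 d12] /andP[i2 u2].
apply: uniq_perm; rewrite ?fset_uniq //.
  by rewrite map_inj_uniq; [rewrite cat_uniq u1 d12 | move=> ? ? []].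
move=> y; rewrite !inE Em !map_cat !mem_cat /= inE.
case: eqVneq => //= ->.
by rewrite !(mem_map (fun a b (e : Posz a = Posz b) => congr1 absz e)) (negPf i1)
   (negPf i2).
Qed.

Fact T_subproof (m : nat) (x : int) :
  x \in first_integers m ->
  perm_eq (T_rotation m x) (first_integers m `\ x).
Proof.
move=> /C_subproof; apply: perm_trans; apply: perm_map.
by rewrite perm_sym perm_catC perm_cat2r perm_sym perm_rev.
Qed.

Definition C_system (m : nat) : rotation_system := RotationSystem (@C_subproof m).

Definition T_system (m : nat) : rotation_system := RotationSystem (@T_subproof m).

(* Main.v *)
(* Enumerate the ground set and color each quadruple a, b, c, d, listed in this
   order, with four signs: the orientation, in the rotation at each of its
   points, of the other three. Ramsey's theorem gives a large sequence of points
   on which the four signs are constant. As soon as there are five points, the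
   first two signs must agree and so must the last two, hence at a point x the
   orientation of i, j, k (in this order) depends only on whether j precedes x.
   The four possibilities for this dependence are the systems C, T and their
   inverses, because a cyclic order is determined by the orientations of its
   triples. *)
Require Import Defs.
From mathcomp Require Import all_boot all_order all_algebra finmap.
From mathcomp Require Import zify.

(** * Ramsey's theorem for finite colorings of [k]-subsequences *)

Lemma pigeonhole_count (T : Type) (C : finType) (f : T -> C) (m : nat)
    (s : seq T) :
  #|C| * m < size s -> exists c, m <= count (fun x => f x == c) s.
Proof.
move=> lt_s; apply/existsP; apply: contraTT lt_s.
rewrite negb_exists -leqNgt => /forallP few.
have ->: size s = \sum_c count (fun x => f x == c) s.
  rewrite -sum1_size (partition_big f xpredT) //=.
  by apply: eq_bigr => c _; rewrite sum1_count.
rewrite -sum_nat_const; apply: leq_sum => c _.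
by move: (few c); rewrite /= -ltnNge => /ltnW.
Qed.

Section Ramsey.
Variables (T : eqType) (C : finType).

Definition homogeneous (color : seq T -> C) (k : nat) (c : C) (t : seq T) :=
  forall u, subseq u t -> size u = k -> color u = c.

(* The color of a [k.+1]-subset of the listed points depends only on its first
   element, and is recorded next to that element. *)
Fixpoint end_homogeneous (color : seq T -> C) (k : nat) (p : seq (T * C)) :=
  if p is (x, c) :: p' then
    homogeneous (fun u => color (x :: u)) k c (unzip1 p')
      /\ end_homogeneous color k p'
  else True.

(** The color of a chosen subsequence is recorded at its first point, and every point kept by the
    filter records [c]. *)
Lemma end_homogeneous_filter (color : seq T -> C) (k : nat) (c : C)
    (p : seq (T * C)) :
  end_homogeneous color k p ->
  homogeneous color k.+1 c (unzip1 [seq q <- p | q.2 == c]).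
Proof.
elim: p => [_ [|y u] //|[x d] p IHp /= [hom_x /IHp hom_p]].
case: eqVneq => [eq_dc|_] /=; last exact: hom_p.
rewrite eq_dc in hom_x; case=> [|y u] //=.
case: eqVneq => [->|_] sub_u [size_u]; last by apply: hom_p; rewrite //= size_u.
apply: hom_x => //; apply: subseq_trans sub_u _.
exact/map_subseq/filter_subseq.
Qed.

Lemma ramsey (k m : nat) :
  exists N, forall (color : seq T -> C) (s : seq T), N <= size s ->
    exists t c, [/\ subseq t s, size t = m & homogeneous color k c t].
Proof.
elim: k m => [|k IHk] m.
  exists m => color s le_ms; exists (take m s), (color [::]).
  by split=> [||[]] //; [exact: take_subseq | rewrite size_takel].
(* Greedy construction: keep the head [x], then shrink the tail by Ramsey for [k], applied to the
   coloring of [u] by the color of [x :: u]. *)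
have pre L : exists N, forall (color : seq T -> C) (s : seq T), N <= size s ->
    exists p, [/\ subseq (unzip1 p) s, size p = L & end_homogeneous color k p].
  elim: L => [|L [N IHL]].
    by exists 0 => color s _; exists [::]; rewrite sub0seq.
  have [N' ramN'] := IHk N; exists N'.+1 => color [|x s] //= le_s.
  have [t [c [sub_t size_t hom_t]]] := ramN' (fun u => color (x :: u)) s le_s.
  have [|p [sub_p size_p hom_p]] := IHL color t; first by rewrite size_t.
  exists ((x, c) :: p); split=> /=; last split=> //.
  - by rewrite eqxx (subseq_trans sub_p).
  - by rewrite size_p.
  by move=> u sub_u; apply: hom_t; apply: subseq_trans sub_p.
(* With more than [#|C| * m] points, some color is recorded at [m] of them at least. *)
have [N preN] := pre (#|C| * m).+1; exists N => color s /(preN color).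
case=> p [sub_p size_p hom_p].
have [|c le_m] := @pigeonhole_count _ _ (@snd T C) m p; first by rewrite size_p.
set q := [seq q <- p | q.2 == c].
exists (take m (unzip1 q)), c; split.
- apply: subseq_trans (take_subseq _ _) _; apply: subseq_trans sub_p.
  exact/map_subseq/filter_subseq.
- by rewrite size_takel // size_map size_filter.
move=> u sub_u; apply: (end_homogeneous_filter _ _ _ _ hom_p).
exact: subseq_trans sub_u (take_subseq _ _).
Qed.

End Ramsey.

(** * Cyclic permutations and orientations of triples *)

Lemma same_cyclic_rev (T : Type) (s t : seq T) :
  same_cyclic s (rev t) -> same_cyclic (rev s) t.
Proof. by case=> k ->; exists (size t - k); rewrite rev_rot revK. Qed.

Lemma subseq_map_nth (T : eqType) (x0 : T) (s : seq T) (I : seq nat) :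
  sorted ltn I -> all (ltn^~ (size s)) I -> subseq (map (nth x0 s) I) s.
Proof.
move=> sorted_I /allP lt_I; rewrite -{2}(mkseq_nth x0 s); apply: map_subseq.
apply/(subseq_uniqP (iota_uniq _ _)).
apply: (irr_sorted_eq ltn_trans ltnn) => //.
  exact/sorted_filter/iota_ltn_sorted/ltn_trans.
move=> i; rewrite mem_filter mem_iota /=.
by case: (boolP (i \in I)) => // /lt_I.
Qed.

Section Orientation.
Variable T : eqType.
Implicit Types (a b c : T) (s : seq T).

(* [a], [b], [c] occur in this cyclic order in the cyclic permutation [s]. *)
Definition cyc s a b c :=
  [|| subseq [:: a; b; c] s, subseq [:: b; c; a] s | subseq [:: c; a; b] s].

Lemma cyc_rot s a b c : cyc s a b c = cyc s b c a.
Proof. by rewrite /cyc orbC -orbA. Qed.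

Lemma cyc_filter (p : pred T) s a b c :
  p a -> p b -> p c -> cyc (filter p s) a b c = cyc s a b c.
Proof. by rewrite /cyc !subseq_filter /= => -> -> ->. Qed.

Lemma cyc_rev s a b c : cyc (rev s) a b c = cyc s c b a.
Proof.
rewrite /cyc -(subseq_rev [:: a; b; c]) -(subseq_rev [:: b; c; a]).
rewrite -(subseq_rev [:: c; a; b]) revK /rev /=.
by congr (_ || _); rewrite orbC.
Qed.

(** Turns orientations into inequalities between indices, so that facts about a few points become
    linear arithmetic. *)
Lemma subseq_index s a b c : uniq s ->
  subseq [:: a; b; c] s =
  [&& index a s < index b s, index b s < index c s & index c s < size s].
Proof.
move=> uniq_s; apply/idP/idP => [sub_abc|/and3P[lt_ab lt_bc lt_c]].
  have: pairwise (relpre (index^~ s) ltn) [:: a; b; c].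
    apply: subseq_pairwise sub_abc _; apply/(pairwiseP a) => i j /= i_s j_s.
    by rewrite /= !index_uniq.
  rewrite /= !andbT index_mem => /andP[/andP[-> _] ->] /=.
  by apply: (mem_subseq sub_abc); rewrite !inE eqxx !orbT.
have in_s x : index x s < size s -> x \in s by rewrite index_mem.
have [lt_a lt_b] : index a s < size s /\ index b s < size s by lia.
rewrite -{1}(nth_index a (in_s _ lt_a)) -{1}(nth_index a (in_s _ lt_b)).
rewrite -{1}(nth_index a (in_s _ lt_c)).
apply: (@subseq_map_nth _ a s [:: index a s; index b s; index c s]) => /=.
  by rewrite lt_ab lt_bc.
by rewrite lt_a lt_b lt_c.
Qed.

Lemma cycE s a b c : uniq s -> a \in s -> b \in s -> c \in s ->
  cyc s a b c = [|| index a s < index b s < index c s,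
    index b s < index c s < index a s | index c s < index a s < index b s].
Proof.
by move=> uniq_s a_s b_s c_s; rewrite /cyc !subseq_index // !index_mem a_s b_s
  c_s !andbT.
Qed.

Lemma cyc_reverse s a b c : uniq s -> uniq [:: a; b; c] ->
  {subset [:: a; b; c] <= s} -> cyc s c b a = ~~ cyc s a b c.
Proof.
move=> uniq_s uniq3 sub_s.
have [a_s b_s c_s] : [/\ a \in s, b \in s & c \in s].
  by split; apply: sub_s; rewrite !inE eqxx ?orbT.
have: uniq [seq index x s | x <- [:: a; b; c]].
  by rewrite map_inj_in_uniq // => x y /sub_s x_s /sub_s y_s /index_inj ->.
rewrite !cycE //= !inE; lia.
Qed.

(** Cut [s] open at [a]: two equal signs mean that [b], [c], [d] follow in this order, or in the
    reverse order, and the sign of [b c d] is then the same. *)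
Lemma cyc_const s a b c d : uniq s -> uniq [:: a; b; c; d] ->
  {subset [:: a; b; c; d] <= s} -> cyc s a b c = cyc s a c d ->
  cyc s b c d = cyc s a b c.
Proof.
move=> uniq_s uniq4 sub_s.
have [a_s b_s c_s d_s] : [/\ a \in s, b \in s, c \in s & d \in s].
  by split; apply: sub_s; rewrite !inE eqxx ?orbT.
have: uniq [seq index x s | x <- [:: a; b; c; d]].
  by rewrite map_inj_in_uniq // => x y /sub_s x_s /sub_s y_s /index_inj ->.
rewrite !cycE //= !inE; lia.
Qed.

(** Invariance under rotation: indices from [s1] go up by [size s2], those from [s2] go down by
    [size s1], and the three cases of [cycE] are at most exchanged. *)
Lemma cyc_catC s1 s2 a b c :
  uniq (s1 ++ s2) -> cyc (s1 ++ s2) a b c -> cyc (s2 ++ s1) a b c.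
Proof.
move=> uniq12 /[dup] cyc_abc.
have [a_s b_s c_s] : [/\ a \in s1 ++ s2, b \in s1 ++ s2 & c \in s1 ++ s2].
  by case/or3P: cyc_abc => /mem_subseq sub; split; apply: sub;
    rewrite !inE eqxx ?orbT.
have mem_swap x : x \in s1 ++ s2 -> x \in s2 ++ s1 by rewrite !mem_cat orbC.
rewrite !cycE ?mem_swap // 1?uniq_catC //.
move: uniq12; rewrite cat_uniq => /and3P[_ /hasPn dis _].
have idx x : x \in s1 ++ s2 ->
  (index x (s1 ++ s2) < size s1) &&
     (index x (s2 ++ s1) == size s2 + index x (s1 ++ s2))
  || (size s1 <= index x (s1 ++ s2) < size s1 + size s2) &&
     (index x (s2 ++ s1) + size s1 == index x (s1 ++ s2)).
  rewrite mem_cat !index_cat => x12.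
  case: (boolP (x \in s1)) x12 => [x1 _|x1 /= x2].
    have /negPf -> : x \notin s2 by apply: contraL x1 => /dis.
    by rewrite index_mem x1 eqxx.
  by rewrite x2 ltn_add2l index_mem x2 leq_addr addnC eqxx orbT.
move: (idx _ a_s) (idx _ b_s) (idx _ c_s); lia.
Qed.

(* Cut [s] open at the head [a] of [t]: the orientations of the triples through
   [a] say that both tails are listed in the same order. *)
Lemma same_cyclicP (t s : seq T) : uniq s -> perm_eq t s ->
  (forall a b c, subseq [:: a; b; c] t -> cyc s a b c) -> same_cyclic t s.
Proof.
case: t => [|a t] uniq_s perm_ts cyc_t.
  by exists 0; move: perm_ts; rewrite perm_sym rot0 => /perm_nilP ->.
have a_s : a \in s by rewrite -(perm_mem perm_ts) mem_head.
set k := index a s; exists k.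
have rot_s := rot_index a_s; set s' := drop _ _ ++ _ in rot_s.
have uniq_rot : uniq (a :: s') by rewrite -rot_s rot_uniq.
have perm_ts' : perm_eq t s'.
  by rewrite -(perm_cons a) -rot_s perm_sym perm_rot perm_sym.
rewrite rot_s; congr (_ :: _).
(* Both tails have the same elements and increase with the index in [s'], hence coincide. *)
apply: (@irr_sorted_eq _ (relpre (index^~ s') ltn)) => [x y z|x|||x] /=.
- exact: ltn_trans.
- by rewrite ltnn.
- rewrite sorted_pairwise; last by move=> x y z; exact: ltn_trans.
  have: forall b c, subseq [:: b; c] t -> index b s' < index c s'.
    move=> b c sub_bc.
    have := cyc_t a b c; rewrite /= eqxx => /(_ sub_bc).
    rewrite -{1}(cat_take_drop k s) => /cyc_catC; rewrite cat_take_drop.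
    rewrite -/(rot k s) => /(_ uniq_s).
    have b_s' : b \in s'.
      by rewrite -(perm_mem perm_ts') (mem_subseq sub_bc) ?mem_head.
    have c_s' : c \in s'.
      by rewrite -(perm_mem perm_ts') (mem_subseq sub_bc) // !inE eqxx orbT.
    (* Since [a] now has index 0, only the case with [a] first can hold. *)
    rewrite rot_s cycE // ?mem_head ?inE ?b_s' ?c_s' ?orbT //= eqxx.
    case: eqVneq => [eq_ab|_]; first by move: uniq_rot; rewrite /= eq_ab b_s'.
    by case: eqVneq => [eq_ac|_]; [move: uniq_rot; rewrite /= eq_ac c_s' | lia].
  elim: (t) => //= x u IHu lt_index; apply/andP; split; last first.
    apply: IHu => b c sub_bc; apply: lt_index.
    exact: subseq_trans sub_bc (subseq_cons _ _).
  by apply/allP => y y_u; apply: lt_index; rewrite eqxx sub1seq.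
- have uniq_s' : uniq s' by case/andP: uniq_rot.
  by apply/(sortedP a) => i lt_i; rewrite /= !index_uniq // ltnW.
exact: perm_mem.
Qed.

Lemma same_cyclic_map (F : nat -> T) (I : seq nat) s :
  uniq s -> perm_eq (map F I) s ->
  (forall i j k, subseq [:: i; j; k] I -> cyc s (F i) (F j) (F k)) ->
  same_cyclic (map F I) s.
Proof.
move=> uniq_s perm_Is cyc_I; apply: same_cyclicP => // a b c.
case/subseqP=> msk size_msk; rewrite -map_mask.
have: subseq (mask msk I) I by exact: mask_subseq.
case: (mask msk I) => [|i [|j [|k [|//]]]] // sub_ijk [-> -> ->].
exact: cyc_I.
Qed.

(** * Recognizing the rotations of C and T by their triples *)

Section Models.
Variables (F : nat -> T) (m x : nat) (s : seq T).
Hypotheses (x_gt0 : 0 < x) (le_xm : x <= m) (uniq_s : uniq s).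
Hypothesis perm_s : perm_eq (map F (iota 1 x.-1 ++ iota x.+1 (m - x))) s.

Lemma same_cyclic_C :
  (forall i j k, 0 < i < j -> j < k <= m -> x \notin [:: i; j; k] ->
     cyc s (F i) (F j) (F k)) ->
  same_cyclic (map F (iota 1 x.-1 ++ iota x.+1 (m - x))) s.
Proof.
move=> cyc_s; apply: same_cyclic_map => // i j k sub_ijk.
have: pairwise ltn [:: i; j; k].
  apply: subseq_pairwise sub_ijk _; rewrite pairwise_cat.
  rewrite -!(sorted_pairwise ltn_trans) !iota_ltn_sorted !andbT.
  by apply/allrelP => a b; rewrite !mem_iota; lia.
have mem_I h : h \in [:: i; j; k] -> (0 < h <= m) && (h != x).
  by move/(mem_subseq sub_ijk); rewrite mem_cat !mem_iota; lia.
have := (mem_I i, mem_I j, mem_I k); rewrite !inE !eqxx !orbT.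
move=> [[/(_ isT) i_I /(_ isT) j_I] /(_ isT) k_I] /= lt_ijk.
by apply: cyc_s; rewrite ?inE; lia.
Qed.

Lemma same_cyclic_T :
  (forall i j k, 0 < i < j -> j < k <= m -> x \notin [:: i; j; k] ->
     if j < x then cyc s (F i) (F j) (F k) else cyc s (F k) (F j) (F i)) ->
  same_cyclic (map F (rev (iota x.+1 (m - x)) ++ iota 1 x.-1)) s.
Proof.
move=> cyc_s; apply: same_cyclic_map => // [|i j k sub_ijk].
  apply: perm_trans perm_s; apply: perm_map.
  by rewrite perm_catC perm_cat2l perm_rev.
(* [a] precedes [b] in the list for T: first the points above [x], decreasing, then those below [x],
   increasing. *)
pose order_T (a b : nat) := [|| a < b < x, x < b < a | b < x < a].
have: pairwise order_T [:: i; j; k].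
  apply: subseq_pairwise sub_ijk _; rewrite pairwise_cat /order_T.
  apply/and3P; split.
  - by apply/allrelP => a b; rewrite mem_rev !mem_iota; lia.
  - have: pairwise gtn (rev (iota x.+1 (m - x))).
      rewrite -sorted_pairwise ?rev_sorted ?iota_ltn_sorted //.
      by move=> a b c /= ab bc; exact: ltn_trans bc ab.
    apply: sub_in_pairwise (allss _) => a b /=; rewrite !mem_rev !mem_iota; lia.
  have: pairwise ltn (iota 1 x.-1).
    by rewrite -(sorted_pairwise ltn_trans) iota_ltn_sorted.
  apply: sub_in_pairwise (allss _) => a b /=; rewrite !mem_iota; lia.
have mem_I h : h \in [:: i; j; k] -> (0 < h <= m) && (h != x).
  by move/(mem_subseq sub_ijk); rewrite mem_cat mem_rev !mem_iota; lia.
have := (mem_I i, mem_I j, mem_I k); rewrite !inE !eqxx !orbT.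
move=> [[/(_ isT) i_I /(_ isT) j_I] /(_ isT) k_I] /=.
rewrite /order_T => r_ijk.
(* The triple lies above [x] (decreasing), below [x] (increasing), or straddles it. In the last case
   its increasing form is [j k i], a rotation, or [k j i], a reversal, according to the side of
   [j]. *)
have [lt_kx|le_xk] := ltnP k x; last first.
  have := cyc_s k j i; rewrite ifF; last by lia.
  by apply; rewrite ?inE; lia.
have [lt_ix|le_xi] := ltnP i x.
  have := cyc_s i j k; rewrite ifT; last by lia.
  by apply; rewrite ?inE; lia.
have [lt_jx|le_xj] := ltnP j x.
  rewrite cyc_rot; have := cyc_s j k i; rewrite lt_kx.
  by apply; rewrite ?inE; lia.
have := cyc_s k j i; rewrite ifF; last by lia.
by apply; rewrite ?inE; lia.
Qed.

End Models.

End Orientation.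

Arguments cyc {T} s a b c.

(** * Consequences of constant orientations *)

Definition orientations (rho : int -> seq int) (u : seq int) :
    bool * bool * bool * bool :=
  if u is [:: a; b; c; d] then
    (cyc (rho a) b c d, cyc (rho b) a c d,
     cyc (rho c) a b d, cyc (rho d) a b c)
  else (true, true, true, true).

(* Seen from a point with one predecessor and three successors, the two triples
   (predecessor, consecutive successors) determine the orientation of the
   successors, so the first two signs of [e] agree; symmetrically for the last
   two. This is where five points are needed. *)
Lemma homogeneous_orientation (rho : int -> seq int) (F : nat -> int) (M : nat)
    (e : bool * bool * bool * bool) :
  5 <= M ->
  (forall i j, 0 < i <= M -> 0 < j <= M -> F i = F j -> i = j) ->
  (forall x, 0 < x <= M -> uniq (rho (F x))) ->
  (forall x i, 0 < x <= M -> 0 < i <= M -> i != x -> F i \in rho (F x)) ->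
  (forall i j k l, 0 < i < j -> j < k < l -> l <= M ->
     orientations rho [:: F i; F j; F k; F l] = e) ->
  exists g : bool -> bool, forall x i j k, 0 < x <= M -> 0 < i < j ->
    j < k <= M -> x \notin [:: i; j; k] ->
    cyc (rho (F x)) (F i) (F j) (F k) = g (j < x)
    /\ cyc (rho (F x)) (F k) (F j) (F i) = ~~ g (j < x).
Proof.
move=> M_ge5 F_inj uniq_rho F_rho.
case: e => [[[e1 e2] e3] e4] orient.
have sub_rho x (I : seq nat) : 0 < x <= M ->
    all (fun i => (0 < i <= M) && (i != x)) I -> {subset map F I <= rho (F x)}.
  move=> x_M /allP I_M y /mapP[i /I_M/andP[i_M ix] ->]; exact: F_rho.
have uniq_F (I : seq nat) : uniq I -> all (fun i => 0 < i <= M) I ->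
    uniq (map F I).
  move=> uniq_I /allP I_M; rewrite map_inj_in_uniq // => i j /I_M iM /I_M jM.
  exact: F_inj.
(* At point 2, the triples 1 3 4 and 1 4 5 have sign [e2], hence so does 3 4 5, whose sign is
   [e1]. *)
have e12 : e1 = e2.
  have [_ E1 _ _] := (orient 1 2 3 4 isT isT ltac:(lia)).
  have [_ E2 _ _] := (orient 1 2 4 5 isT isT ltac:(lia)).
  have [E3 _ _ _] := (orient 2 3 4 5 isT isT ltac:(lia)).
  rewrite -E3 -E1; apply: cyc_const; rewrite ?E1 ?E2 //.
  - by apply: uniq_rho; lia.
  - by apply: (uniq_F [:: 1; 3; 4; 5]) => //=; lia.
  by apply: (sub_rho 2 [:: 1; 3; 4; 5]) => /=; lia.
have e34 : e3 = e4.
  have [_ _ E1 _] := (orient 1 2 4 5 isT isT ltac:(lia)).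
  have [_ _ E2 _] := (orient 2 3 4 5 isT isT ltac:(lia)).
  have [_ _ _ E3] := (orient 1 2 3 4 isT isT ltac:(lia)).
  (* At point 4, the triples are rotated to start at the successor 5, which plays the part of [a] in
     [cyc_const]. *)
  move: E1 E2; rewrite -!(cyc_rot _ _ (F 5)) => E1 E2.
  rewrite -E3 -E1; apply: esym; apply: cyc_const; rewrite ?E1 ?E2 //.
  - by apply: uniq_rho; lia.
  - by apply: (uniq_F [:: 5; 1; 2; 3]) => //=; lia.
  by apply: (sub_rho 4 [:: 5; 1; 2; 3]) => /=; lia.
(* If [j < x], then [x] is third or fourth in its quadruple; otherwise it is first or second. *)
exists (fun left => if left then e3 else e2) => x i j k x_M ij jk.
rewrite !inE !negb_or => x_ijk.
have cyc_F : cyc (rho (F x)) (F i) (F j) (F k) = if j < x then e3 else e2.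
  have [lt_xj|le_jx] := ltnP j x; have [lt1|le1] := ltnP x i.
  - lia.
  - have [lt2|le2] := ltnP x k.
      by have [] := orient i j x k ij ltac:(lia) ltac:(lia).
    by have [_ _ _ ->] := orient i j k x ij ltac:(lia) ltac:(lia).
  - by have [-> _ _ _] := orient x i j k ltac:(lia) ltac:(lia) ltac:(lia).
  by have [_ -> _ _] := orient i x j k ltac:(lia) ltac:(lia) ltac:(lia).
split=> //; rewrite -cyc_F; apply: cyc_reverse; first exact: uniq_rho.
  by apply: (uniq_F [:: i; j; k]); rewrite /= ?inE; lia.
by apply: (sub_rho x [:: i; j; k]) => /=; lia.
Qed.

(** * Extraction of the subsystem *)

Local Open Scope fset_scope.

Theorem theorem2 (m : nat) (m_gt0 : 1 <= m) :
  exists n0 : nat, forall P : rotation_system, n0 <= #|` ground P| ->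
    exists (S : {fset int}) (sSP : S `<=` ground P),
      [\/ equivalent (induced sSP) (C_system m),
          equivalent (induced sSP) (T_system m),
          equivalent (induced sSP) (inverse (C_system m))
        | equivalent (induced sSP) (inverse (T_system m))].
Proof.
(* The models need [m] points, the equalities between signs need five. *)
have [N ramN] := ramsey int (bool * bool * bool * bool)%type 4 (maxn m 5).
exists N => P /(ramN (orientations (rotation P)))[t [e [sub_t size_t hom_t]]].
set M := maxn m 5 in size_t.
have uniq_t : uniq t by exact: subseq_uniq sub_t (fset_uniq _).
(* The labels of the models start at 1, the positions in [t] at 0; hence the predecessor. *)
pose f (z : int) : int := nth 0%R t (absz z).-1; pose F i := f (Posz i).
have F_P i : 0 < i <= M -> F i \in ground P.
  move=> i_M; apply: (mem_subseq sub_t).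
  by apply: mem_nth; rewrite size_t /=; lia.
have F_inj i j : 0 < i <= M -> 0 < j <= M -> F i = F j -> i = j.
  move=> i_M j_M /eqP; rewrite nth_uniq ?size_t //=; lia.
have mem_rho x : 0 < x <= M -> rotation P (F x) =i ground P `\ F x.
  by move=> x_M; apply: perm_mem; exact/rotationP/F_P.
have uniq_rho x : 0 < x <= M -> uniq (rotation P (F x)).
  by move=> x_M; rewrite (perm_uniq (rotationP (F_P x x_M))) fset_uniq.
have [||i j k l ij kl lM|g cyc_g] :=
  homogeneous_orientation (rotation P) F M e _ F_inj uniq_rho.
- by rewrite leq_maxr.
- move=> x i x_M i_M ix; rewrite mem_rho // !inE F_P // andbT.
  by apply: contra ix => /eqP /F_inj -> //.
- apply: hom_t => //.
  apply: (@subseq_map_nth _ 0%R t [:: i.-1; j.-1; k.-1; l.-1]);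
    by rewrite /= ?size_t; lia.
have le_mM : m <= M by rewrite leq_maxl.
pose S := f @` first_integers m.
have sSP : S `<=` ground P.
  apply/fsubsetP => y /imfsetP[z /= /first_integersP[i i_m ->] ->].
  by apply: F_P; lia.
have F_S i : 0 < i <= m -> F i \in S.
  move=> i_m; apply/imfsetP; exists (Posz i) => //=.
  by apply/first_integersP; exists i.
exists S, sSP.
pose s x := rotation (induced sSP) (F x).
have equivalentP Q : ground Q = first_integers m ->
    (forall x, 0 < x <= m -> same_cyclic (map f (rotation Q x)) (s x)) ->
    equivalent (induced sSP) Q.
  move=> ground_Q rot_Q; exists f; rewrite ground_Q; split=> //.
    move=> _ _ /first_integersP[i i_m ->] /first_integersP[j j_m ->].
    by move=> /F_inj -> //; lia.
  by move=> _ /first_integersP[i i_m ->]; apply: rot_Q.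
have uniq_s x : 0 < x <= m -> uniq (s x).
  by move=> x_m; rewrite filter_uniq // uniq_rho //; lia.
have perm_s x : 0 < x <= m ->
    perm_eq (map F (iota 1 x.-1 ++ iota x.+1 (m - x))) (s x).
  move=> x_m; have mem_I i : i \in iota 1 x.-1 ++ iota x.+1 (m - x) =
      (0 < i <= m) && (i != x) by rewrite mem_cat !mem_iota; lia.
  apply: uniq_perm; rewrite ?uniq_s //.
    rewrite map_inj_in_uniq => [|i j]; last first.
      by rewrite !mem_I => i_I j_I /F_inj -> //; lia.
    rewrite cat_uniq !iota_uniq andbT; apply/hasPn => i.
    by rewrite /= !mem_iota; lia.
  move=> y; rewrite mem_filter mem_rho; last by lia.
  rewrite in_fsetD1; apply/mapP/and3P => [[i]|[]].
    rewrite mem_I => /andP[i_m ix] ->; rewrite F_S // F_P; last by lia.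
    by split=> //; apply: contra ix => /eqP /F_inj -> //; lia.
  case/imfsetP=> z /= /first_integersP[i i_m ->] -> Fix _; exists i => //.
  by rewrite mem_I i_m; apply: contraNN Fix => /eqP ->.
have cyc_s x i j k : 0 < x <= m -> 0 < i < j -> j < k <= m ->
    x \notin [:: i; j; k] ->
    cyc (s x) (F i) (F j) (F k) = g (j < x)
    /\ cyc (s x) (F k) (F j) (F i) = ~~ g (j < x).
  move=> x_m ij jk x_ijk.
  rewrite !cyc_filter ?F_S //; [apply: cyc_g => //|..]; lia.
have mapC x : map f (C_rotation m (Posz x)) =
    map F (iota 1 x.-1 ++ iota x.+1 (m - x)) by rewrite -map_comp.
have mapT x : map f (T_rotation m (Posz x)) =
    map F (rev (iota x.+1 (m - x)) ++ iota 1 x.-1) by rewrite -map_comp.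
(* For [i < j < k], the sign at [x] is always true in C, and in T it is true exactly when [j < x];
   the inverses have the opposite signs. *)
case g_left: (g true); case g_right: (g false).
- apply: Or41; apply: equivalentP => // x /[dup] x_m /andP[x_gt0 le_xm].
  rewrite mapC; apply: same_cyclic_C => // [||i j k ij jk x_ijk]; auto.
  have [-> _] := cyc_s x i j k x_m ij jk x_ijk; by case: (j < x).
- apply: Or42; apply: equivalentP => // x /[dup] x_m /andP[x_gt0 le_xm].
  rewrite mapT; apply: same_cyclic_T => // [||i j k ij jk x_ijk]; auto.
  have [-> ->] := cyc_s x i j k x_m ij jk x_ijk.
  by case: (j < x); rewrite ?g_left ?g_right.
- apply: Or44; apply: equivalentP => // x /[dup] x_m /andP[x_gt0 le_xm].
  (* Instead of inverting the model, reverse the rotation of the subsystem, which flips all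
     signs. *)
  rewrite map_rev; apply: same_cyclic_rev.
  rewrite mapT; apply: same_cyclic_T => // [||i j k ij jk x_ijk].
  + by rewrite rev_uniq uniq_s.
  + by rewrite perm_sym perm_rev perm_sym perm_s.
  rewrite !cyc_rev; have [-> ->] := cyc_s x i j k x_m ij jk x_ijk.
  by case: (j < x); rewrite ?g_left ?g_right.
apply: Or43; apply: equivalentP => // x /[dup] x_m /andP[x_gt0 le_xm].
rewrite map_rev; apply: same_cyclic_rev.
rewrite mapC; apply: same_cyclic_C => // [||i j k ij jk x_ijk].
- by rewrite rev_uniq uniq_s.
- by rewrite perm_sym perm_rev perm_sym perm_s.
rewrite !cyc_rev; have [_ ->] := cyc_s x i j k x_m ij jk x_ijk.
by case: (j < x); rewrite ?g_left ?g_right.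
Qed.
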